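(* Let $K$ be a field, $r\geq 3$, $S=K[x_1,\ldots,x_r]$, and let $G$ be a simple graph without isolated vertices on the vertex set $[r]=\{1,\ldots,r\}$, with Stanley–Reisner ideal $I_G\subseteq S$. Then for all $n\geq 1$, $$a_2(S/I_G^n)=\begin{cases}3n-3, & \mathrm{girth}(G)=3;\\ 2n-2, & \mathrm{girth}(G)=4;\\ 2n-3, & 5\leq\mathrm{girth}(G)<\infty\text{ and } n\geq 2;\\ 0, & 5\leq\mathrm{girth}(G)<\infty\text{ and } n=1;\\ 2n-3, & \mathrm{girth}(G)=\infty\text{ and }\deg(G)\geq 2;\\ n-3, & \mathrm{girth}(G)=\infty\text{ and }\deg(G)=1.\end{cases}$$
   Context: A simple graph is an undirected graph with no loops and no parallel edges. $G$ is regarded as a one-dimensional simplicial complex with faces $\emptyset$, the vertices and the edges, and $I_G=(\prod_{i\in F}x_i: F\subseteq[r]\text{ not a face})=\bigcap_{e\in E(G)}(x_i: i\in[r]\setminus e)$. $\deg(G)$ is the maximal degree of the vertices of $G$; $\mathrm{girth}(G)$ is the smallest length of a cycle of $G$ (a triangle has length 3), with $\mathrm{girth}(G)=\infty$ if $G$ has no cycles. With $\mathfrak m=(x_1,\ldots,x_r)$ and $S$ standard graded, $a_2(S/I_G^n):=\max\{t: H^2_{\mathfrak m}(S/I_G^n)_t\neq 0\}$, where $H^2_{\mathfrak m}$ is the second local cohomology module and $\max\emptyset=-\infty$. *)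

(* Defs.v *)
From mathcomp Require Import all_boot all_order all_algebra.
From mathcomp Require Import mpoly.

Set Implicit Arguments.
Unset Strict Implicit.
Unset Printing Implicit Defensive.

Import Order.TTheory GRing.Theory Num.Theory.
Local Open Scope ring_scope.

(* The maximum of a set of integers: [is_max P (Some a)] says that it is
   attained and equal to [a], and [None] stands for max(empty set) = -oo. *)
Definition is_max (P : int -> Prop) (m : option int) : Prop :=
  if m is Some a then P a /\ (forall t, P t -> t <= a)
  else forall t, ~ P t.

Section Ideals.

Variable R : comNzRingType.

Definition ideal_gen (A : R -> Prop) (p : R) : Prop :=
  exists s : seq (R * R),
    (forall c, c \in s -> A c.2) /\ p = \sum_(c <- s) c.1 * c.2.

Definition ideal_exp (I : R -> Prop) (n : nat) : R -> Prop :=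
  ideal_gen (fun p => exists f : 'I_n -> R,
    (forall i, I (f i)) /\ p = \prod_(i < n) f i).

End Ideals.

(* Simple graphs are symmetric irreflexive relations [e] on a finite type. *)
Section Graphs.

Variables (T : finType) (e : rel T).

(* The faces of the graph viewed as a one-dimensional simplicial complex: the
   sets with at most one element are the empty set and the vertices. *)
Definition is_face (F : {set T}) : bool :=
  (#|F| <= 1)%N || [exists i, exists j, e i j && (F == [set i; j])].

Definition max_degree : nat := \max_(i : T) #|[set j | e i j]|.

Definition has_cycle_of_length (k : nat) : bool :=
  (3 <= k)%N && [exists c : k.-tuple T, cycle e c && uniq c].

(* The girth, with [None] standing for +oo.  Restricting the search to
   k <= #|T| loses nothing, see [girthP]. *)
Definition girth : option nat :=
  ohead [seq k <- iota 0 #|T|.+1 | has_cycle_of_length k].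

Lemma girthP :
  if girth is Some g
  then has_cycle_of_length g /\
       (forall k, has_cycle_of_length k -> (g <= k)%N)
  else forall k, ~~ has_cycle_of_length k.
Proof.
have bnd k : has_cycle_of_length k -> k \in iota 0 #|T|.+1.
  case/andP=> _ /existsP[c /andP[_ uc]].
  by rewrite mem_iota /= add0n ltnS -(size_tuple c) -(card_uniqP uc) max_card.
have mem k : has_cycle_of_length k ->
    k \in [seq k <- iota 0 #|T|.+1 | has_cycle_of_length k].
  by move=> hk; rewrite mem_filter hk bnd.
rewrite /girth; case def_s: [seq _ <- _ | _] mem => [|g s] mem /=.
  by move=> k; apply/negP => /mem.
have : sorted leq (g :: s).
  rewrite -def_s; apply: sorted_filter; first exact: leq_trans.
  exact: iota_sorted.
rewrite /= path_sortedE; last exact: leq_trans.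
case/andP=> /allP gle _; split.
  by have := mem_head g s; rewrite -def_s mem_filter => /andP[].
by move=> k /mem; rewrite inE => /predU1P[->|/gle].
Qed.

End Graphs.

Section LocalCohomology.

Variables (K : fieldType) (r : nat).

Local Notation S := {mpoly K[r]}.
Local Notation Q := {fraction {mpoly K[r]}}.

Definition x_ (s : {set 'I_r}) : S := \prod_(i in s) 'X_i.

(* The localization J S_{x_s} of an ideal J of S at the powers of x_s, inside
   the fraction field of S. *)
Definition loc (s : {set 'I_r}) (J : S -> Prop) (f : Q) : Prop :=
  exists p k, J p /\ f = tofrac p / tofrac (x_ s ^+ k).

(* [f] is an element of degree t of the Z-graded ring S_{x_s}. *)
Definition loc_homog (s : {set 'I_r}) (t : int) (f : Q) : Prop :=
  exists (p : S) (k : nat),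
    (forall m, m \in msupp p -> (mdeg m)%:Z = t + (k * #|s|)%:Z) /\
    f = tofrac p / tofrac (x_ s ^+ k).

(* The differential C^{i-1} -> C^i of the Cech complex of x_1, ..., x_r.  The
   components of a cochain all live in the fraction field of S, so that the
   localization maps S_{x_(s \ j)} -> S_{x_s} are inclusions. *)
Definition cech_diff (c : {set 'I_r} -> Q) (s : {set 'I_r}) : Q :=
  \sum_(j in s) (-1) ^+ #|[set k in s | (k < j)%N]| * c (s :\ j).

(* The degree t part of the i-th local cohomology H^i_m(S/J), m = (x_1,...,x_r),
   does not vanish, for a homogeneous ideal J.  H^i_m(S/J) is the i-th cohomology
   of the Cech complex
     C^i = \bigoplus_(#|s| = i) (S/J)_{x_s},  (S/J)_{x_s} = S_{x_s} / J S_{x_s};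
   a cochain is given by representatives in the S_{x_s}, and equalities in
   (S/J)_{x_s} are membership of the difference in J S_{x_s}. *)
Definition local_cohomology_neq0 (J : S -> Prop) (i : nat) (t : int) : Prop :=
  exists c : {set 'I_r} -> Q,
    [/\ forall s : {set 'I_r}, #|s| = i -> loc_homog s t (c s),
        forall s : {set 'I_r}, #|s| = i.+1 -> loc s J (cech_diff c s)
      & ~ exists b : {set 'I_r} -> Q,
          (forall s : {set 'I_r}, #|s|.+1 = i -> loc s (fun=> True) (b s)) /\
          (forall s : {set 'I_r}, #|s| = i -> loc s J (c s - cech_diff b s))].

(* a_i(S/J) = a. *)
Definition is_a_invariant (J : S -> Prop) (i : nat) (a : option int) : Prop :=
  is_max (local_cohomology_neq0 J i) a.

Definition stanley_reisner (face : {set 'I_r} -> bool) : S -> Prop :=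
  ideal_gen (fun p => exists F : {set 'I_r}, ~~ face F /\ p = x_ F).

End LocalCohomology.

(* Main.v *)
Require Import Defs.
From mathcomp Require Import all_boot all_order all_algebra.
From mathcomp Require Import mpoly.
From mathcomp Require Import zify.

(** Write J = I_G^n.  A set s of at least two vertices that is not an edge is a
    nonface, so x_s^n is in J and J S_(x_s) = S_(x_s); at an edge s one has
    I_G S_(x_s) = P_s S_(x_s), where P_s is generated by the variables off s.  The
    Cech complex of S/J thus vanishes in cohomological degree 3, and H^2 is the
    cokernel of the map from the sum of the (S/J)_(x_v) to the sum over the edges s
    of S_(x_s) / P_s^n S_(x_s).  That sum has a basis of Laurent monomials: x^a
    survives at the edge {u, v} iff a is nonnegative off {u, v} and its part off
    {u, v} has degree less than n.  Call {u, v} alive for a in that case.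

    Everything is graded by the exponents a, and the component of degree a is a
    computation in the graph of alive edges, a case of Takayama's formula: the
    cochain x^a at the edge {i, j} is a coboundary iff some function beta from the
    vertices to K jumps by 1 across {i, j} and by 0 across all other alive edges,
    where beta v must vanish if a has a negative entry other than at v, since then
    x^a is not in S_(x_v).  One direction builds the coboundary from beta
    ([potential_coboundary]), the other one takes coefficients at x^a
    ([coboundary_potential]).

    There are three ways for beta not to exist:
    - a is negative at both ends of an alive edge; the largest degree of such an a
      is n - 3, attained by putting n - 1 at a third vertex;
    - a is negative at one vertex only and two alive edges meet there; the largest
      degree is 2n - 3, attained by -1 at the center and n - 1 at the two leaves;
    - a is nonnegative and the alive edges contain a cycle.
    Otherwise beta is an indicator function, up to sign: of one end of a leaf edge,
    or of the component of one end after the removal of a bridge.  Adding the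
    inequalities of the edges of an alive cycle bounds the degree of a: by 3n - 3
    for a triangle, by 2n - 2 (two disjoint edges) from length 4 on, and by 2n - 3
    from length 5 on if n >= 2.  The first two bounds are attained on a triangle
    and a square, and for n = 1 every cycle is alive in degree 0.  Comparing these
    maxima according to the girth and the degree gives the formula. *)

Set Implicit Arguments.
Unset Strict Implicit.
Unset Printing Implicit Defensive.

Import Order.TTheory GRing.Theory Num.Theory.

(** * Powers of ideals *)

Section IdealPowers.

Local Open Scope ring_scope.

Variable R : comNzRingType.
Implicit Types (A I P : R -> Prop) (p q : R).

Lemma ideal_gen_mem A p : A p -> ideal_gen A p.
Proof.
move=> Ap; exists [:: (1, p)]; split; first by move=> c /[!inE]/eqP->.
by rewrite big_seq1 mul1r.
Qed.

Lemma ideal_gen0 A : ideal_gen A 0.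
Proof. by exists [::]; split=> //; rewrite big_nil. Qed.

Lemma ideal_genD A p q : ideal_gen A p -> ideal_gen A q -> ideal_gen A (p + q).
Proof.
move=> [s [sA ->]] [s' [s'A ->]]; exists (s ++ s'); rewrite big_cat; split=> // c.
by rewrite mem_cat => /orP[/sA|/s'A].
Qed.

Lemma ideal_genM A p q : ideal_gen A q -> ideal_gen A (p * q).
Proof.
move=> [s [sA ->]]; exists [seq (p * c.1, c.2) | c <- s]; split.
  by move=> _ /mapP[c /sA ? ->].
by rewrite big_map mulr_sumr; apply: eq_bigr => c _; rewrite mulrA.
Qed.

Lemma ideal_gen_ind A P :
  P 0 -> (forall p q, P p -> P q -> P (p + q)) ->
  (forall p q, A q -> P (p * q)) -> forall p, ideal_gen A p -> P p.
Proof.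
move=> P0 PD PA _ [s [sA ->]]; rewrite big_seq.
by elim/big_ind: _ => // c /sA; apply: PA.
Qed.

Lemma ideal_exp0_one I : ideal_exp I 0 1.
Proof. by apply: ideal_gen_mem; exists (fun=> 0); split=> [[]|]; rewrite ?big_ord0. Qed.

Lemma ideal_expS I n p q :
  I p -> ideal_exp I n q -> ideal_exp I n.+1 (p * q).
Proof.
move=> Ip; move: q; apply: ideal_gen_ind => [|q q' ? ?|a _ [f [If ->]]].
- by rewrite mulr0; apply: ideal_gen0.
- by rewrite mulrDr; apply: ideal_genD.
rewrite mulrCA; apply/ideal_genM/ideal_gen_mem.
exists (fun i => if unlift ord0 i is Some j then f j else p); split.
  by move=> i; case: unliftP.
rewrite big_ord_recl unlift_none; congr (_ * _).
by apply: eq_bigr => i _; rewrite liftK.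
Qed.

Lemma ideal_exp_pow I n p : I p -> ideal_exp I n (p ^+ n).
Proof.
move=> Ip; elim: n => [|n IHn]; first exact: ideal_exp0_one.
by rewrite exprS; apply: ideal_expS.
Qed.

End IdealPowers.

(** * Localizations at squarefree monomials *)

Section Localization.

Local Open Scope ring_scope.

Variables (K : fieldType) (r : nat).

Local Notation S := {mpoly K[r]}.
Local Notation Q := {fraction {mpoly K[r]}}.
Local Notation tofrac := (@tofrac {mpoly K[r]}).

Implicit Types (a b : 'I_r -> int) (s : {set 'I_r}) (m d : 'X_{1..r}) (f g : Q).

Definition laurent a : Q := \prod_i tofrac 'X_i ^ a i.

Definition ldeg a : int := \sum_i a i.

Lemma tofracX_neq0 m : tofrac 'X_[m] != 0.
Proof. by rewrite tofrac_eq0 -msupp_eq0 msuppX. Qed.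

Lemma laurent_eq a b : a =1 b -> laurent a = laurent b.
Proof. by move=> ab; apply: eq_bigr => i _; rewrite ab. Qed.

Lemma laurentD a b : laurent (fun i => a i + b i) = laurent a * laurent b.
Proof.
by rewrite -big_split; apply: eq_bigr => i _; rewrite expfzDr // tofracX_neq0.
Qed.

Lemma laurent_mnm m : laurent (fun i => (m i)%:Z) = tofrac 'X_[m].
Proof. by rewrite mpolyXE_id rmorph_prod; apply: eq_bigr => i _; rewrite rmorphXn. Qed.

Lemma sum_mem_card s : (\sum_i (i \in s) = #|s|)%N.
Proof.
by rewrite -sum1_card [RHS]big_mkcond; apply: eq_bigr => i _; case: (i \in s).
Qed.

Definition xmnm s k : 'X_{1..r} := [multinom ((i \in s) * k)%N | i < r].

Lemma x_powE s k : x_ K s ^+ k = 'X_[xmnm s k].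
Proof.
rewrite mpolyXE_id -prodrXl big_mkcond; apply: eq_bigr => i _; rewrite mnmE.
by case: (i \in s); rewrite ?mul1n // expr0.
Qed.

Lemma tofrac_x_neq0 s k : tofrac (x_ K s ^+ k) != 0.
Proof. by rewrite x_powE tofracX_neq0. Qed.

Lemma laurent_clear a m d :
  (forall i, (m i)%:Z = a i + (d i)%:Z) -> laurent a = tofrac 'X_[m] / tofrac 'X_[d].
Proof.
move=> md; apply: (canRL (mulfK (tofracX_neq0 d))).
by rewrite -!laurent_mnm -laurentD; apply/esym/laurent_eq.
Qed.

Lemma laurent_den a s : (forall i, i \notin s -> 0 <= a i) -> exists k m,
  (forall i, (m i)%:Z = a i + ((i \in s) * k)%:Z) /\
  laurent a = tofrac 'X_[m] / tofrac (x_ K s ^+ k).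
Proof.
move=> a_ge0; exists (\max_i `|a i|)%N; set k := (\max_i _)%N.
pose m := [multinom `|(a i + ((i \in s) * k)%:Z)%R|%N | i < r]; exists m.
have mE i : (m i)%:Z = a i + ((i \in s) * k)%:Z.
  have := leq_bigmax (F := fun i => `|a i|%N) i; have := a_ge0 i.
  by rewrite mnmE -/k; case: (i \in s) => /= [_|/(_ isT)]; lia.
by split=> //; rewrite x_powE; apply: laurent_clear => i; rewrite mE mnmE.
Qed.

Lemma Posz_sum (I : finType) (P : pred I) (F : I -> nat) :
  (\sum_(i | P i) F i)%N%:Z = \sum_(i | P i) (F i)%:Z.
Proof. exact: (big_morph Posz PoszD). Qed.

Section Loc.

Variable J : S -> Prop.
Hypothesis J0 : J 0.
Hypothesis JD : forall p q, J p -> J q -> J (p + q).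
Hypothesis JM : forall p q, J q -> J (p * q).

Lemma loc0 s : loc s J 0.
Proof. by exists 0, 0%N; rewrite rmorph0 mul0r. Qed.

Lemma locD s f g : loc s J f -> loc s J g -> loc s J (f + g).
Proof.
move=> [p [k [Jp ->]]] [q [l [Jq ->]]].
exists (x_ K s ^+ l * p + x_ K s ^+ k * q), (k + l)%N; split.
  by apply: JD; apply: JM.
have := tofrac_x_neq0 s k; have := tofrac_x_neq0 s l; rewrite exprD.
move: (_ ^+ k) (_ ^+ l) => u v v0 u0.
rewrite tofracD !tofracM (addf_div _ _ u0 v0).
by rewrite [tofrac v * _]mulrC [tofrac u * tofrac q]mulrC.
Qed.

Lemma locM s p f : loc s J f -> loc s J (tofrac p * f).
Proof.
move=> [q [k [Jq ->]]]; exists (p * q), k; split; first exact: JM.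
by rewrite rmorphM mulrA.
Qed.

Lemma loc_sum (I : finType) (P : pred I) (F : I -> Q) s :
  (forall i, P i -> loc s J (F i)) -> loc s J (\sum_(i | P i) F i).
Proof. by move=> sF; elim/big_ind: _ => //; [apply: loc0|move=> *; apply: locD]. Qed.

Lemma locN s f : loc s J f -> loc s J (- f).
Proof. by move/(locM (-1)); rewrite rmorphN1 mulN1r. Qed.

Lemma locB s f g : loc s J f -> loc s J g -> loc s J (f - g).
Proof. by move=> Jf /locN; apply: locD. Qed.

End Loc.

Definition locT s := loc s (fun _ : S => True).

Lemma locT_mono s s' f : s \subset s' -> locT s f -> locT s' f.
Proof.
move=> ss' [p [k [_ ->]]]; exists (p * x_ K (s' :\: s) ^+ k), k; split=> //.
have -> : x_ K s' = x_ K s * x_ K (s' :\: s).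
  by rewrite /x_ (big_setID s) /= (setIidPr ss').
by rewrite exprMn !rmorphM -mulf_div divff ?mulr1 // tofrac_x_neq0.
Qed.

Lemma locT_laurent a s : (forall i, i \notin s -> 0 <= a i) -> locT s (laurent a).
Proof.
by move=> /laurent_den[k [m [_ ->]]]; exists 'X_[m], k.
Qed.

Lemma loc_homog0 s t : loc_homog s t (0 : Q).
Proof.
exists 0, 0%N; split; last by rewrite rmorph0 mul0r.
by move=> m; rewrite -mpolyC0 msupp0.
Qed.

Lemma loc_homog_laurent a s : (forall i, i \notin s -> 0 <= a i) ->
  loc_homog s (ldeg a) (laurent a).
Proof.
move=> /laurent_den[k [m [mE ->]]]; exists 'X_[m], k; split=> // m'.
rewrite msuppX inE => /eqP->; rewrite /ldeg mdegE Posz_sum.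
rewrite (eq_bigr _ (fun i _ => mE i)).
by rewrite big_split /= -Posz_sum -big_distrl /= sum_mem_card mulnC.
Qed.

(** * Coefficients of Laurent polynomials *)

(** The coefficient at x^a of a Laurent polynomial [f].  It is a relation because
    [f] lives in the fraction field, where no coefficient map exists: [z] is read off
    a polynomial obtained by clearing a monomial denominator, and [lcoef_inj] shows
    that the choice of the denominator does not matter. *)
Definition lcoef a f (z : K) := exists (d m : 'X_{1..r}) (p : S),
  [/\ forall i, (m i)%:Z = a i + (d i)%:Z, f * tofrac 'X_[d] = tofrac p & z = p@_m].

Lemma lcoef_inj a f z z' : lcoef a f z -> lcoef a f z' -> z = z'.
Proof.
move=> [d [m [p [md fp ->]]]] [d' [m' [p' [md' fp' ->]]]].
have eq_p : p * 'X_[d'] = p' * 'X_[d].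
  by apply/eqP; rewrite -tofrac_eq !rmorphM /= -fp -fp' mulrAC.
have eq_m : (d' + m)%MM = (d + m')%MM.
  by apply/mnmP => i; rewrite !mnmDE; have := md i; have := md' i; lia.
by rewrite -(mcoeffMX p d') eq_p eq_m mcoeffMX.
Qed.

Lemma lcoefB a f g z w : lcoef a f z -> lcoef a g w -> lcoef a (f - g) (z - w).
Proof.
move=> [d [m [p [md fp ->]]]] [d' [m' [p' [md' fp' ->]]]].
exists (d + d')%MM, (d' + m)%MM, (p * 'X_[d'] - p' * 'X_[d]); split.
- by move=> i; rewrite !mnmDE; have := md i; lia.
- by rewrite mpolyXD !(rmorphM, rmorphB) /= mulrBl -fp -fp' mulrA (mulrAC g) mulrA.
have eq_m : (d' + m)%MM = (d + m')%MM.
  by apply/mnmP => i; rewrite !mnmDE; have := md i; have := md' i; lia.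
by rewrite mcoeffB mcoeffMX eq_m mcoeffMX.
Qed.

(** Besides the existence of a coefficient, this locates the monomial of the
    numerator it comes from; all vanishing results for coefficients rest on that. *)
Lemma lcoef_frac a p d : exists z, lcoef a (tofrac p / tofrac 'X_[d]) z /\
  (z != 0 -> exists2 m, m \in msupp p & forall i, (m i)%:Z = a i + (d i)%:Z).
Proof.
pose d0 := [multinom `|a i|%N | i < r].
pose m0 := [multinom `|(a i + (`|a i|%N)%:Z)%R|%N | i < r].
exists (p * 'X_[d0])@_(d + m0); split.
  exists (d + d0)%MM, (d + m0)%MM, (p * 'X_[d0]); split=> //.
    by move=> i; rewrite !mnmDE !mnmE; lia.
  by rewrite mpolyXD !rmorphM /= mulrA divfK ?tofracX_neq0.
rewrite -mcoeff_msupp (perm_mem (msuppMX _ _)) => /mapP[m mp eq_m]; exists m => // i.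
by have /mnmP/(_ i) := eq_m; rewrite !mnmDE !mnmE; lia.
Qed.

Lemma lcoef_laurent a : lcoef a (laurent a) 1.
Proof.
pose d := [multinom `|a i|%N | i < r].
pose m := [multinom `|(a i + (`|a i|%N)%:Z)%R|%N | i < r].
have md i : (m i)%:Z = a i + (d i)%:Z by rewrite !mnmE; lia.
exists d, m, 'X_[m]; split=> //; last by rewrite mcoeffX eqxx.
by rewrite (laurent_clear md) divfK ?tofracX_neq0.
Qed.

Lemma lcoef0 a : lcoef a 0 0.
Proof. by have := lcoefB (lcoef_laurent a) (lcoef_laurent a); rewrite !subrr. Qed.

Lemma lcoef_locT a s f : locT s f -> exists z, lcoef a f z.
Proof.
case=> p [k [_ ->]]; rewrite x_powE.
by have [z []] := lcoef_frac a p (xmnm s k); exists z.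
Qed.

Lemma lcoef_locT0 a s f k : locT s f -> k \notin s -> a k < 0 -> lcoef a f 0.
Proof.
case=> p [l [_ ->]]; rewrite x_powE; have [z [zP z0]] := lcoef_frac a p (xmnm s l).
move=> kNs ak; have [zz|/z0[m _ /(_ k)]] := eqVneq z 0; first by rewrite -zz.
by rewrite mnmE (negPf kNs); lia.
Qed.

End Localization.

(** * Localizations of the powers of the ideal of a graph at its edges *)

Section Graph.

Local Open Scope ring_scope.

Variables (K : fieldType) (r : nat) (e : rel 'I_r) (n : nat).
Hypotheses (e_sym : ssrbool.symmetric e) (e_irr : irreflexive e).

Local Notation S := {mpoly K[r]}.
Local Notation Q := {fraction {mpoly K[r]}}.
Local Notation tofrac := (@tofrac {mpoly K[r]}).
Local Notation J := (ideal_exp (stanley_reisner (K := K) (is_face e)) n).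

Implicit Types (a : 'I_r -> int) (s : {set 'I_r}) (m : 'X_{1..r}) (f : Q).

Lemma edge_irr u v : e u v -> u != v.
Proof. by apply: contraTneq => ->; rewrite e_irr. Qed.

(** The order at the prime generated by the variables off [s]: [n <= odeg s m] says
    that the monomial with exponent [m] is in the n-th power of that prime. *)
Definition odeg s m : nat := \sum_(i | i \notin s) m i.

Lemma odegD s m m' : odeg s (m + m')%MM = (odeg s m + odeg s m')%N.
Proof. by rewrite -big_split; apply: eq_bigr => i _; rewrite mnmDE. Qed.

Definition odeg_ge s d (p : S) := forall m, m \in msupp p -> (d <= odeg s m)%N.

Lemma odeg_ge0 s d : odeg_ge s d 0.
Proof. by move=> m; rewrite -mpolyC0 msupp0. Qed.

Lemma odeg_geD s d p q : odeg_ge s d p -> odeg_ge s d q -> odeg_ge s d (p + q).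
Proof. by move=> pd qd m /msuppD_le; rewrite mem_cat => /orP[/pd|/qd]. Qed.

Lemma odeg_geM s d d' p q :
  odeg_ge s d p -> odeg_ge s d' q -> odeg_ge s (d + d')%N (p * q).
Proof.
move=> pd qd m /msuppM_le/allpairsP[[m1 m2] /= [/pd m1d /qd m2d ->]].
by rewrite odegD leq_add.
Qed.

Lemma odeg_geMl s d p q : odeg_ge s d q -> odeg_ge s d (p * q).
Proof. exact: (@odeg_geM s 0). Qed.

(** A set contained in an edge is a face; hence I_G is contained in the prime of the
    edge. *)
Lemma nonface_notin_edge u v F : e u v -> ~~ is_face e F ->
  exists2 i, i \in F & i \notin [set u; v].
Proof.
move=> euv FN; apply/subsetPn; apply: contraNN FN => Fuv; rewrite /is_face.
have [->|neF] := eqVneq F [set u; v].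
  apply/orP; right; apply/existsP; exists u.
  by apply/existsP; exists v; rewrite euv eqxx.
have := proper_card (A := F) (B := [set u; v]); rewrite properEneq neF Fuv => /(_ isT).
by rewrite cards2 edge_irr // ltnS => ->.
Qed.

Lemma graph_power_odeg u v p : e u v -> J p -> odeg_ge [set u; v] n p.
Proof.
move=> euv; move: p; apply: ideal_gen_ind; first exact: odeg_ge0.
  exact: odeg_geD.
move=> p _ [f [fI ->]]; apply: odeg_geMl.
have {}fI i : odeg_ge [set u; v] 1 (f i).
  move: (f i) (fI i); apply: ideal_gen_ind; first exact: odeg_ge0.
    exact: odeg_geD.
  move=> q _ [F [/(nonface_notin_edge euv)[k kF kN] ->]]; apply: odeg_geMl => m.
  rewrite -(expr1 (x_ _ _)) x_powE msuppX inE => /eqP->.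
  by rewrite /odeg (bigD1 k) //= mnmE kF.
elim: n f fI => [|d IHd] f fI; first by move=> m _.
by rewrite big_ord_recl; apply: (@odeg_geM _ 1 d) => //; apply: IHd.
Qed.

Lemma nonface_x F : ~~ is_face e F -> stanley_reisner (is_face e) (x_ K F).
Proof. by move=> FN; apply: ideal_gen_mem; exists F. Qed.

Lemma nonface_card s : (2 < #|s|)%N -> ~~ is_face e s.
Proof.
move=> s3; rewrite /is_face negb_or -ltnNge (ltn_trans _ s3) //=.
apply: contraTN s3 => /existsP[i /existsP[j /andP[_ /eqP->]]].
by rewrite cards2; case: (_ != _).
Qed.

(** This is why J and the n-th power of the prime of the edge {u, v} agree after
    inverting x_u x_v: for i off {u, v} the set {i, u, v} has three elements, hence
    is a nonface, so that each factor x_i of the monomial can be paired with one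
    factor x_u x_v. *)
Lemma monomial_graph_power u v m d : e u v -> (d <= odeg [set u; v] m)%N ->
  ideal_exp (stanley_reisner (is_face e)) d ('X_[m] * x_ K [set u; v] ^+ d).
Proof.
move=> euv; elim: d m => [|d IHd] m dm.
  by apply: ideal_genM; rewrite expr0; apply: ideal_exp0_one.
have [i iN im] : exists2 i, i \notin [set u; v] & (0 < m i)%N.
  apply/exists_inP; apply: contraLR dm => /exists_inPn dm.
  by rewrite /odeg big1 // => i /dm; rewrite -eqn0Ngt => /eqP.
have mE : m = (U_(i) + (m - U_(i)))%MM.
  by rewrite addmC submK //; apply/mnm_lepP => j; rewrite mnm1E; case: eqP => // <-.
have -> : 'X_[m] * x_ K [set u; v] ^+ d.+1 =
    x_ K (i |: [set u; v]) * ('X_[m - U_(i)] * x_ K [set u; v] ^+ d).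
  by rewrite {1}mE mpolyXD exprS /x_ [in RHS]big_setU1 //= mulrACA.
apply: ideal_expS.
  by apply/nonface_x/nonface_card; rewrite cardsU1 iN cards2 edge_irr.
apply: IHd; move: dm; rewrite {1}mE odegD.
have -> : odeg [set u; v] U_(i)%MM = 1%N; last by rewrite add1n.
rewrite /odeg (bigD1 i) //= mnm1E eqxx big1 // => j /andP[_ ji].
by rewrite mnm1E eq_sym (negPf ji).
Qed.

Lemma graph_power0 : J 0. Proof. exact: ideal_gen0. Qed.
Lemma graph_powerD p q : J p -> J q -> J (p + q). Proof. exact: ideal_genD. Qed.
Lemma graph_powerM p q : J q -> J (p * q). Proof. exact: ideal_genM. Qed.

Lemma loc_nonface s f : ~~ is_face e s -> locT s f -> loc s J f.
Proof.
move=> sN [p [k [_ ->]]]; exists (p * x_ K s ^+ n), (k + n)%N; split.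
  by apply/graph_powerM/ideal_exp_pow/nonface_x.
by rewrite exprD !rmorphM -mulf_div divff ?mulr1 // tofrac_x_neq0.
Qed.

Lemma sum_off u v a : u != v ->
  ldeg a = \sum_(i | i \notin [set u; v]) a i + a u + a v.
Proof.
move=> uv; rewrite /ldeg (bigD1 v) // (bigD1 u) //= addrC; congr (_ + _).
by rewrite addrC; congr (_ + _); apply: eq_bigl => i; rewrite !inE negb_or andbC.
Qed.

(** Says that x^a is a nonzero element of (S/J)_(x_u x_v).  The last condition is
    that the part of [a] off {u, v} has degree at most n - 1; written with the total
    degree, it can be added up over several edges. *)
Definition alive a u v : bool :=
  [&& e u v, [forall k, (k != u) && (k != v) ==> (0 <= a k)]
    & ldeg a < n%:Z + a u + a v].

Lemma alive_sym a : ssrbool.symmetric (alive a).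
Proof.
move=> u v; rewrite /alive e_sym addrAC; congr [&& _, _ & _].
by apply: eq_forallb => k; rewrite andbC.
Qed.

Lemma alive_edge a u v : alive a u v -> e u v.
Proof. by case/and3P. Qed.

Lemma alive_ge0 a u v k : alive a u v -> k \notin [set u; v] -> 0 <= a k.
Proof. by case/and3P=> _ /forallP/(_ k)/implyP + _; rewrite !inE negb_or. Qed.

Lemma lcoef_graph_power a u v f : alive a u v -> loc [set u; v] J f -> lcoef a f 0.
Proof.
move=> auv [p [k [Jp ->]]]; rewrite x_powE.
have euv := alive_edge auv.
have [z [zP z0]] := lcoef_frac a p (xmnm [set u; v] k).
have [<- //|/z0[m /(graph_power_odeg euv Jp) mn mE]] := eqVneq z 0.
case/and3P: auv => _ _; rewrite (sum_off _ (edge_irr euv)).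
suff -> : \sum_(i | i \notin [set u; v]) a i = (odeg [set u; v] m)%:Z by lia.
by rewrite Posz_sum; apply: eq_bigr => i /negPf iN; rewrite mE mnmE iN addr0.
Qed.

Lemma loc_dead a u v : e u v -> (forall k, k \notin [set u; v] -> 0 <= a k) ->
  ~~ alive a u v -> loc [set u; v] J (laurent K a).
Proof.
move=> euv a_ge0; rewrite /alive euv /=; case: forallP => /= [_|[]]; last first.
  by move=> k; apply/implyP => kuv; rewrite a_ge0 // !inE negb_or.
rewrite (sum_off _ (edge_irr euv)) => an.
have [k [m [mE ->]]] := laurent_den K a_ge0.
exists ('X_[m] * x_ K [set u; v] ^+ n), (k + n)%N; split; last first.
  by rewrite exprD !rmorphM -mulf_div divff ?mulr1 // tofrac_x_neq0.
apply: monomial_graph_power => //.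
suff : \sum_(i | i \notin [set u; v]) a i = (odeg [set u; v] m)%:Z by lia.
by rewrite Posz_sum; apply: eq_bigr => i /negPf iN; rewrite mE iN addr0.
Qed.

End Graph.

(** * Coboundaries and potentials *)

Section Potentials.

Local Open Scope ring_scope.

Variables (K : fieldType) (r : nat) (e : rel 'I_r) (n : nat).
Hypotheses (e_sym : ssrbool.symmetric e) (e_irr : irreflexive e).

Local Notation S := {mpoly K[r]}.
Local Notation Q := {fraction {mpoly K[r]}}.
Local Notation tofrac := (@tofrac {mpoly K[r]}).
Local Notation J := (ideal_exp (stanley_reisner (K := K) (is_face e)) n).

Implicit Types (a : 'I_r -> int) (s : {set 'I_r}) (b c : {set 'I_r} -> Q).
Implicit Types (beta : 'I_r -> K) (u v i j : 'I_r).

Lemma set2_inj (T : finType) (u v x y : T) :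
  [set u; v] = [set x; y] -> u = x /\ v = y \/ u = y /\ v = x.
Proof.
move=> /setP eq_uv; have := eq_uv u; have := eq_uv v; have := eq_uv x; have := eq_uv y.
rewrite !inE !eqxx /= !orbT !(eq_sym x) !(eq_sym y).
by do 4!case: eqP => ?; subst=> //=; auto.
Qed.

Lemma ord_lt_neq u v : (u < v)%N -> u != v.
Proof. by apply: contraTneq => ->; rewrite ltnn. Qed.

Lemma card2_lt s : #|s| = 2%N -> exists u v : 'I_r, (u < v)%N /\ s = [set u; v].
Proof.
move/eqP/cards2P => [u [v [uv ->]]]; case: (ltngtP u v) => [lt_uv|lt_vu|/val_inj eq_uv].
- by exists u, v; split.
- by exists v, u; split=> //; rewrite setUC.
- by rewrite eq_uv eqxx in uv.
Qed.

Lemma face2_edge u v : u != v -> is_face e [set u; v] -> e u v.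
Proof.
move=> uv; rewrite /is_face cards2 uv /=.
case/existsP=> x /existsP[y /andP[exy /eqP/set2_inj[[-> ->]|[-> ->]]]] //.
by rewrite e_sym.
Qed.

Lemma cech_diff2 c u v : (u < v)%N ->
  cech_diff c [set u; v] = c [set v] - c [set u].
Proof.
move=> lt_uv; have uv := ord_lt_neq lt_uv.
rewrite /cech_diff big_setU1 ?inE //= big_set1.
have -> : [set k in [set u; v] | (k < u)%N] = set0.
  apply/setP => k; rewrite !inE; have [->|_] := eqVneq k u; rewrite ?ltnn ?andbF //=.
  by case: eqP => //= ->; rewrite ltnNge (ltnW lt_uv).
have -> : [set k in [set u; v] | (k < v)%N] = [set u].
  apply/setP => k; rewrite !inE; have [->|_] := eqVneq k u; rewrite ?lt_uv //=.
  by have [->|_] := eqVneq k v; rewrite ?ltnn.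
rewrite cards0 cards1 expr0 expr1 mul1r mulN1r; congr (c _ - c _); apply/setP => k.
  by rewrite !inE; have [->|] := eqVneq k u; rewrite ?(negPf uv).
by rewrite !inE; have [->|] := eqVneq k v; rewrite ?orbF // eq_sym (negPf uv).
Qed.

Definition coboundary c := exists b,
  (forall s, #|s|.+1 = 2%N -> locT s (b s)) /\
  (forall s, #|s| = 2%N -> loc s J (c s - cech_diff b s)).

Lemma coboundary_ext c c' :
  (forall s, #|s| = 2%N -> c s = c' s) -> coboundary c -> coboundary c'.
Proof.
move=> cc' [b [bT cb]]; exists b; split=> // s s2.
by rewrite -(cc' s s2); apply: cb.
Qed.

Lemma coboundary_null c : (forall s, #|s| = 2%N -> loc s J (c s)) -> coboundary c.
Proof.
move=> cJ; exists (fun=> 0); split=> [s _|s s2]; first exact: loc0.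
rewrite /cech_diff big1; last by move=> j _; rewrite mulr0.
by rewrite subr0; apply: cJ.
Qed.

Lemma coboundaryD c c' :
  coboundary c -> coboundary c' -> coboundary (fun s => c s + c' s).
Proof.
move=> [b [bT cb]] [b' [bT' cb']]; exists (fun s => b s + b' s); split=> s s2.
  by apply: locD => //; [apply: bT|apply: bT'].
have -> : cech_diff (fun s => b s + b' s) s = cech_diff b s + cech_diff b' s.
  by rewrite -big_split; apply: eq_bigr => j _; rewrite mulrDr.
rewrite opprD addrACA.
by apply: locD; [exact: graph_powerD|exact: graph_powerM|exact: cb|exact: cb'].
Qed.

Lemma coboundaryM p c : coboundary c -> coboundary (fun s => tofrac p * c s).
Proof.
move=> [b [bT cb]]; exists (fun s => tofrac p * b s); split=> s s2.
  by apply: locM => //; apply: bT.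
have -> : cech_diff (fun s => tofrac p * b s) s = tofrac p * cech_diff b s.
  by rewrite mulr_sumr; apply: eq_bigr => j _; rewrite mulrCA.
by rewrite -mulrBr; apply: locM; [exact: graph_powerM|exact: cb].
Qed.

Lemma coboundary_sum (I : eqType) (l : seq I) (F : I -> {set 'I_r} -> Q) :
  (forall x, x \in l -> coboundary (F x)) ->
  coboundary (fun s => \sum_(x <- l) F x s).
Proof.
elim: l => [|x l IHl] Fl.
  by apply: coboundary_null => s _; rewrite big_nil; apply/loc0/graph_power0.
apply: (@coboundary_ext (fun s => F x s + \sum_(x <- l) F x s)).
  by move=> s _; rewrite big_cons.
apply: coboundaryD; first by apply: Fl; rewrite mem_head.
by apply: IHl => y yl; apply: Fl; rewrite inE yl orbT.
Qed.

Definition delta s f : {set 'I_r} -> Q := fun s' => if s' == s then f else 0.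

(** The coordinates at x^a of a 0-cochain on the graph with coboundary x^a at the
    edge {i, j}: [beta v] is the coefficient of x^a in the component at [v]. *)
Definition potential a i j beta :=
  (forall v k, k != v -> a k < 0 -> beta v = 0) /\
  (forall u v, (u < v)%N -> alive e n a u v ->
     beta v - beta u = ([set u; v] == [set i; j])%:R).

(** The cochain with value [beta v] x^a at [v] works: its defect at a pair {u, v} is a
    multiple of x^a, with coefficient 0 if {u, v} is alive, and otherwise it already
    lies in the localization of J, unless x^a has a negative exponent off {u, v}, in
    which case both [beta u] and [beta v] vanish. *)
Lemma potential_coboundary a i j beta :
  (forall k, k \notin [set i; j] -> 0 <= a k) -> potential a i j beta ->
  coboundary (delta [set i; j] (laurent K a)).
Proof.
move=> a_ge0 [beta0 beta1].
pose b s := \sum_(v | s == [set v]) tofrac (beta v)%:MP * laurent K a.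
have bE v : b [set v] = tofrac (beta v)%:MP * laurent K a.
  by rewrite /b (big_pred1 v) // => w; rewrite (inj_eq set1_inj) eq_sym.
have bT v : locT [set v] (b [set v]).
  rewrite bE; have [->|bv] := eqVneq (beta v) 0.
    by rewrite mpolyC0 rmorph0 mul0r; apply: loc0.
  apply: locM => //; apply: locT_laurent => k; rewrite inE => kv.
  by rewrite leNgt; apply: contra_neqN bv; apply: beta0.
exists b; split=> s.
  by case=> /eqP/cards1P[v ->]; apply: bT.
move/card2_lt => [u [v [lt_uv ->]]].
have uv := ord_lt_neq lt_uv.
rewrite cech_diff2 //.
have [uv_face|] := boolP (is_face e [set u; v]); last first.
  move/loc_nonface; apply; apply: locB => //; last first.
    by apply: locB => //; [apply: (locT_mono _ (bT v))|apply: (locT_mono _ (bT u))];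
       rewrite sub1set !inE eqxx ?orbT.
  rewrite /delta; case: eqP => [->|_]; last exact: loc0.
  exact: locT_laurent.
have euv := face2_edge uv uv_face; rewrite !bE.
have -> : delta [set i; j] (laurent K a) [set u; v] -
    (tofrac (beta v)%:MP * laurent K a - tofrac (beta u)%:MP * laurent K a) =
  tofrac (([set u; v] == [set i; j])%:R - (beta v - beta u))%:MP * laurent K a.
  rewrite !mpolyCB !tofracB !mulrBl; congr (_ - _); rewrite /delta.
  by case: (_ == _); rewrite ?mpolyC0 ?mpolyC1 ?rmorph0 ?rmorph1 ?mul0r ?mul1r.
have [a_uv|a_uv] := boolP (alive e n a u v).
  by rewrite beta1 // subrr mpolyC0 rmorph0 mul0r; apply/loc0/graph_power0.
have [/forall_inP a_off|/forall_inPn[k kuv]] :=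
    boolP [forall k in ~: [set u; v], 0 <= a k].
  apply: locM; first exact: graph_powerM.
  by apply: loc_dead => // k kuv; apply: a_off; rewrite inE.
rewrite -ltNge => ak; move: (kuv); rewrite !inE negb_or => /andP[ku kv].
rewrite (beta0 u k) // (beta0 v k) // (_ : _ == _ = false).
  by rewrite !subr0 mpolyC0 rmorph0 mul0r; apply/loc0/graph_power0.
apply: contraTF ak => /eqP eq_uv; rewrite -leNgt; apply: a_ge0.
by rewrite -eq_uv; rewrite inE in kuv.
Qed.

(** The coefficients at x^a of a cochain [b] bounding x^a at {i, j} form a potential:
    at an alive edge no element of the localization of J has a nonzero coefficient
    at x^a. *)
Lemma coboundary_potential a i j :
  coboundary (delta [set i; j] (laurent K a)) -> exists beta, potential a i j beta.
Proof.
move=> [b [bT cb]].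
have {}bT v : locT [set v] (b [set v]) by apply: bT; rewrite cards1.
have /fin_all_exists[beta betaP] v : exists z, lcoef a (b [set v]) z.
  exact: lcoef_locT (bT v).
exists beta; split=> [v k kv ak|u v lt_uv a_uv].
  by apply: (lcoef_inj (betaP v)); apply: lcoef_locT0 (bT v) _ ak; rewrite inE.
have uv := ord_lt_neq lt_uv.
have := cb [set u; v]; rewrite cards2 uv => /(_ erefl); rewrite cech_diff2 //.
move/(lcoef_graph_power e_irr a_uv)/lcoef_inj => cb0.
apply/esym/subr0_eq/esym/cb0; apply: lcoefB; last exact: lcoefB.
by rewrite /delta; case: eqP => _; [apply: lcoef_laurent|apply: lcoef0].
Qed.

(** Every 2-cochain is a cocycle modulo J, because sets of three vertices are
    nonfaces. *)
Lemma no_potential_neq0 a i j :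
  i != j -> (forall k, k \notin [set i; j] -> 0 <= a k) ->
  (forall beta, ~ potential a i j beta) ->
  local_cohomology_neq0 J 2 (ldeg a).
Proof.
move=> ij a_ge0 no_beta; exists (delta [set i; j] (laurent K a)); split.
- move=> s s2; rewrite /delta; case: eqP => [->|_]; last exact: loc_homog0.
  exact: loc_homog_laurent.
- move=> s s3; apply: loc_nonface; first by apply: nonface_card; rewrite s3.
  apply: loc_sum => // k ks; rewrite -(rmorph_sign tofrac); apply: locM => //.
  rewrite /delta; case: eqP => [sk|_]; last exact: loc0.
  by apply: (@locT_mono _ _ [set i; j]); [rewrite -sk subD1set|exact: locT_laurent].
- by move=> /coboundary_potential[beta /no_beta].
Qed.

(** The 2-cochains of degree [t] are spanned by the cochains with a single monomial
    at a single pair of vertices. *)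
Lemma all_potentials_eq0 t :
  (forall a i j, alive e n a i j -> ldeg a = t ->
     exists beta, potential a i j beta) ->
  ~ local_cohomology_neq0 J 2 t.
Proof.
move=> all_beta [c [c_homog _]]; apply.
have laurent_cob a s : #|s| = 2%N -> (forall k, k \notin s -> 0 <= a k) ->
    ldeg a = t -> coboundary (delta s (laurent K a)).
  move=> /card2_lt[u [v [lt_uv ->]]] a_ge0 at_.
  have uv := ord_lt_neq lt_uv.
  have [/all_beta/(_ at_)[beta /potential_coboundary]|dead] := boolP (alive e n a u v).
    exact.
  apply: coboundary_null => s' _; rewrite /delta.
  case: eqP => [->|_]; last exact/loc0/graph_power0.
  have [/(face2_edge uv) euv|] := boolP (is_face e [set u; v]); first exact: loc_dead.
  by move/loc_nonface; apply; apply: locT_laurent.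
have delta_cob s : #|s| = 2%N -> coboundary (delta s (c s)).
  move=> s2; have [p [k [pt ->]]] := c_homog s s2.
  pose a (m : 'X_{1..r}) i : int := (m i)%:Z - ((i \in s) * k)%:Z.
  apply: (@coboundary_ext
    (fun s' => \sum_(m <- msupp p) tofrac (p@_m)%:MP * delta s (laurent K (a m)) s')).
    move=> s' _; rewrite /delta; case: eqP => [_|_]; last first.
      by rewrite big1 // => m _; rewrite mulr0.
    rewrite [in RHS](mpolyE p) rmorph_sum /= mulr_suml; apply: eq_bigr => m _.
    rewrite -mul_mpolyC tofracM -mulrA x_powE; congr (_ * _).
    by apply: laurent_clear => i; rewrite /a mnmE subrK.
  apply: coboundary_sum => m mp; apply/coboundaryM/laurent_cob => //.
    by move=> i /negPf iN; rewrite /a iN subr0.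
  rewrite /ldeg /a sumrB -Posz_sum -mdegE (pt m mp) -Posz_sum -big_distrl /=.
  by rewrite sum_mem_card mulnC addrK.
apply: (@coboundary_ext (fun s' =>
  \sum_(s <- enum [set s : {set 'I_r} | #|s| == 2]) delta s (c s) s')).
  move=> s' s2; rewrite big_enum (bigD1 s') ?inE ?s2 //= /delta eqxx big1 ?addr0 //.
  by move=> s /andP[_ /negPf ss']; rewrite eq_sym ss'.
by apply: coboundary_sum => s; rewrite mem_enum inE => /eqP; apply: delta_cob.
Qed.

End Potentials.

(** * The graph of alive edges *)

Section AliveGraph.

Local Open Scope ring_scope.

Variables (K : fieldType) (r : nat) (e : rel 'I_r) (n : nat).
Hypotheses (e_sym : ssrbool.symmetric e) (e_irr : irreflexive e).

Local Notation J := (ideal_exp (stanley_reisner (K := K) (is_face e)) n).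
Local Notation alive := (alive e n).
Local Notation potential := (@potential K r e n).

Implicit Types (a : 'I_r -> int) (u v i j k : 'I_r) (c l : seq 'I_r).

Lemma alive_neq a u v : alive a u v -> u != v.
Proof. by move/alive_edge/(edge_irr e_irr). Qed.

Lemma alive_lt a u v : alive a u v -> ldeg a < n%:Z + a u + a v.
Proof. by case/and3P. Qed.

Lemma sum_uniq_le a l : (forall k, 0 <= a k) -> uniq l ->
  \sum_(k <- l) a k <= ldeg a.
Proof.
move=> a_ge0 l_uniq; rewrite big_uniq //= [leRHS]/ldeg [leRHS](bigID (mem l)) /= lerDl.
by apply: sumr_ge0.
Qed.

(** The sum of the three inequalities, where the entries of [a] on the triangle add up
    to at most [ldeg a]. *)
Lemma alive_cycle3 a c : (forall k, 0 <= a k) -> uniq c -> cycle (alive a) c ->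
  size c = 3%N -> ldeg a <= 3 * n%:Z - 3.
Proof.
move=> a_ge0 c_uniq + c_size; case: c c_size c_uniq => [|x [|y [|z []]]] // _ c_uniq.
rewrite /= => /and4P[/alive_lt xy /alive_lt yz /alive_lt zx _].
by have := sum_uniq_le a_ge0 c_uniq; rewrite !big_cons big_nil; lia.
Qed.

(** Two disjoint edges of the cycle suffice. *)
Lemma alive_cycle4 a c : (forall k, 0 <= a k) -> uniq c -> cycle (alive a) c ->
  (4 <= size c)%N -> ldeg a <= 2 * n%:Z - 2.
Proof.
move=> a_ge0 c_uniq + c_size.
case: c c_size c_uniq => [|x [|y [|z [|w c]]]] // _ c_uniq.
rewrite /= => /and4P[/alive_lt xy _ /alive_lt zw _].
have := @sum_uniq_le a [:: x; y; z; w] a_ge0; rewrite !big_cons big_nil => le_sum.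
have {}le_sum := le_sum (subseq_uniq (prefix_subseq [:: x; y; z; w] c) c_uniq).
by lia.
Qed.

(** For length 5 the sum of the five inequalities gives 3 deg a <= 5 (n - 1); for a
    greater length three disjoint edges give 2 deg a <= 3 (n - 1).  Both bounds are at
    most 2n - 3 after rounding down. *)
Lemma alive_cycle5 a c : (forall k, 0 <= a k) -> uniq c -> cycle (alive a) c ->
  (5 <= size c)%N -> (2 <= n)%N -> ldeg a <= 2 * n%:Z - 3.
Proof.
move=> a_ge0 c_uniq + c_size n2.
case: c c_size c_uniq => [|x [|y [|z [|w [|t c]]]]] // _ c_uniq.
case: c c_uniq => [|s c] c_uniq /=.
  case/and5P => /alive_lt xy /alive_lt yz /alive_lt zw /alive_lt wt.
  case/andP=> /alive_lt tx _.
  by have := sum_uniq_le a_ge0 c_uniq; rewrite !big_cons big_nil; lia.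
case/and5P => /alive_lt xy _ /alive_lt zw _ /andP[/alive_lt ts _].
have := @sum_uniq_le a [:: x; y; z; w; t; s] a_ge0; rewrite !big_cons big_nil => le_sum.
have {}le_sum := le_sum (subseq_uniq (prefix_subseq [:: x; y; z; w; t; s] c) c_uniq).
by lia.
Qed.

(** The sum of the inequalities at {i, j} and {i, k}, where a j + a k is at most
    deg a - a i and a i is at most -1. *)
Lemma alive_branch a i j k : alive a i j -> alive a i k -> j != k -> a i < 0 ->
  ldeg a <= 2 * n%:Z - 3.
Proof.
move=> aij aik jk ai; have ij := alive_neq aij; have ik := alive_neq aik.
have : a i + a j + a k <= ldeg a.
  rewrite (sum_off _ ij) (bigD1 k) /=; last first.
    by rewrite !inE negb_or ![k == _]eq_sym ik jk.
  set s := \sum_(_ | _) _; suff : 0 <= s by lia.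
  by apply: sumr_ge0 => v /andP[vN _]; apply: alive_ge0 aij vN.
by have := alive_lt aij; have := alive_lt aik; lia.
Qed.

Lemma path_last_cycle (h : rel 'I_r) i j p :
  path (fun u v => h u v && ([set u; v] != [set i; j])) j p -> uniq (j :: p) ->
  last j p = i -> h i j -> i != j ->
  [/\ uniq (j :: p), (3 <= size (j :: p))%N & cycle h (j :: p)].
Proof.
move=> jp p_uniq p_last hij ij; split=> //; last first.
  rewrite /= rcons_path p_last hij andbT.
  by apply: sub_path jp => u v /andP[].
case: p jp {p_uniq} p_last => [_ /= ji|x [|y p] //]; first by rewrite ji eqxx in ij.
by move=> + /= xi; rewrite /= xi setUC eqxx andbF.
Qed.

(** Without alive cycles {i, j} is a bridge of the graph of alive edges, and the
    indicator function of the component of [j] after its removal jumps across no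
    other alive edge. *)
Lemma acyclic_potential a i j : (forall k, 0 <= a k) -> alive a i j ->
  (forall c, uniq c -> (3 <= size c)%N -> ~~ cycle (alive a) c) ->
  exists beta, potential a i j beta.
Proof.
move=> a_ge0 aij acyclic; have ij := alive_neq aij.
pose h u v := alive a u v && ([set u; v] != [set i; j]).
have h_sym : connect_sym h.
  by apply: sym_connect_sym => u v; rewrite /h (alive_sym n e_sym) setUC.
have ji : connect h j i = false.
  apply/negP => /connectP[p jp p_last].
  case/shortenP: jp p_last => p' jp' p'_uniq _ /esym p'_last.
  have [c_uniq c_size] := path_last_cycle jp' p'_uniq p'_last aij ij.
  by apply/negP/acyclic.
(* A potential is oriented by the order of the vertices, hence the sign. *)
exists (fun v => (-1) ^+ (j < i)%N * (connect h j v)%:R); split.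
  by move=> v k _; rewrite ltNge a_ge0.
move=> u v lt_uv auv; have [eq_uv|neq_uv] := eqVneq [set u; v] [set i; j].
  case: (set2_inj eq_uv) lt_uv => -[-> ->] lt_ij; rewrite connect0 ji mulr0 mulr1.
    by rewrite ltnNge ltnW //= subr0.
  by rewrite lt_ij sub0r opprK.
have huv : h u v by rewrite /h auv.
by rewrite (same_connect_r h_sym (connect1 huv)) subrr.
Qed.

(** Every alive edge contains [i], because [a i] is negative; so {i, j} is the only
    one, and the indicator function of [i] is a potential up to sign. *)
Lemma leaf_potential a i j : a i < 0 -> 0 <= a j -> alive a i j ->
  (forall k, alive a i k -> k = j) -> exists beta, potential a i j beta.
Proof.
move=> ai aj aij leaf; exists (fun v => (-1) ^+ (i < j)%N * (v == i)%:R); split.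
  move=> v k kv ak; have [vi|] := eqVneq v i; last by rewrite mulr0.
  have : k \notin [set i; j].
    rewrite !inE -vi negb_or kv /=; apply: contraTneq ak => ->.
    by rewrite -leNgt.
  by move/(alive_ge0 aij); rewrite leNgt ak.
move=> u v lt_uv auv.
have : i \in [set u; v].
  by apply: contraTT ai => /(alive_ge0 auv); rewrite leNgt.
have ij := alive_neq aij.
rewrite !inE => /orP[]/eqP iE; subst i.
  rewrite (leaf _ auv) in lt_uv *.
  by rewrite eqxx lt_uv [j == u]eq_sym (negPf ij) mulr0 mulr1 sub0r opprK eqxx.
rewrite alive_sym // in auv; rewrite (leaf _ auv) in lt_uv *.
by rewrite eqxx ltnNge ltnW //= [j == v]eq_sym (negPf ij) setUC eqxx mulr0 mulr1 subr0.
Qed.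

Lemma potentialC a i j beta : potential a i j beta -> potential a j i beta.
Proof. by rewrite /potential [[set j; i]]setUC. Qed.

(** The three hypotheses exclude, in this order, an alive edge with two negative
    entries, two alive edges meeting at a negative entry, and a cycle of alive edges
    with nonnegative entries. *)
Lemma local_cohomology_eq0 t :
  n%:Z - 3 < t ->
  (forall i j k, e i j -> e i k -> j != k -> 2 * n%:Z - 3 < t) ->
  (forall a c, (forall k, 0 <= a k) -> ldeg a = t -> uniq c -> (3 <= size c)%N ->
     ~~ cycle (alive a) c) ->
  ~ local_cohomology_neq0 J 2 t.
Proof.
move=> t_edge t_branch t_cycle.
apply: (all_potentials_eq0 e_sym e_irr) => a i j aij at_.
have one_neg u v : alive a u v -> a u < 0 -> 0 <= a v ->
    exists beta, potential a u v beta.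
  move=> auv au av; apply: leaf_potential => // k auk; apply: contraTeq isT => kv.
  have vk : v != k by rewrite eq_sym.
  have := t_branch _ _ _ (alive_edge auv) (alive_edge auk) vk.
  by rewrite ltNge -at_ (alive_branch auv auk vk au).
have [ai|ai] := ltP (a i) 0; have [aj|aj] := ltP (a j) 0.
- by have := alive_lt aij; rewrite at_; lia.
- exact: one_neg.
- have aji : alive a j i by rewrite alive_sym.
  by have [beta /potentialC] := one_neg _ _ aji aj ai; exists beta.
have a_ge0 k : 0 <= a k.
  have [|kN] := boolP (k \in [set i; j]); last exact: alive_ge0 aij kN.
  by rewrite !inE => /orP[]/eqP->.
by apply: acyclic_potential => // c *; apply: t_cycle.
Qed.

Lemma potential_eq a i j beta u v : potential a i j beta -> alive a u v ->
  [set u; v] != [set i; j] -> beta u = beta v.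
Proof.
move=> [_ beta1] auv neq_uv; apply/esym/eqP; rewrite -subr_eq0.
case: (ltngtP u v) => [lt_uv|lt_vu|/val_inj->]; last by rewrite subrr.
  by rewrite beta1 // (negPf neq_uv).
by rewrite -opprB oppr_eq0 beta1 // 1?alive_sym // setUC (negPf neq_uv).
Qed.

Lemma potential_neq a i j beta : potential a i j beta -> alive a i j ->
  beta i != beta j.
Proof.
move=> [_ beta1] aij; have ij := alive_neq aij.
case: (ltngtP i j) => [lt_ij|lt_ji|/val_inj eq_ij]; last by rewrite eq_ij eqxx in ij.
  by rewrite eq_sym -subr_eq0 beta1 // eqxx oner_neq0.
by rewrite -subr_eq0 beta1 // 1?alive_sym // setUC eqxx oner_neq0.
Qed.

Lemma alive_neq0 a i j : alive a i j -> (forall beta, ~ potential a i j beta) ->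
  local_cohomology_neq0 J 2 (ldeg a).
Proof.
move=> aij; apply: no_potential_neq0 => //; first exact: alive_neq aij.
by move=> k; apply: alive_ge0 aij.
Qed.

(** A potential would have to vanish at both ends of the edge, yet differ there. *)
Lemma two_negative_neq0 a i j : alive a i j -> a i < 0 -> a j < 0 ->
  local_cohomology_neq0 J 2 (ldeg a).
Proof.
move=> aij ai aj; apply: (alive_neq0 aij) => beta pot; have ij := alive_neq aij.
have := potential_neq pot aij; case: pot => beta0 _.
by rewrite (beta0 i j) 1?eq_sym // (beta0 j i) ?eqxx.
Qed.

(** A potential vanishes at [j] and [k], and agrees at [i] and [k]; so it cannot jump
    across {i, j}. *)
Lemma branch_neq0 a i j k : alive a i j -> alive a i k -> j != k -> a i < 0 ->
  local_cohomology_neq0 J 2 (ldeg a).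
Proof.
move=> aij aik jk ai; apply: (alive_neq0 aij) => beta pot.
have ij := alive_neq aij; have ik := alive_neq aik.
have ik_ij : [set i; k] != [set i; j].
  apply: contraNneq jk => /setP/(_ k); rewrite !inE eqxx orbT eq_sym (negPf ik) /=.
  by move/esym/eqP->.
have := potential_neq pot aij; rewrite (potential_eq pot aik ik_ij).
by case: pot => beta0 _; rewrite (beta0 j i) // (beta0 k i) ?eqxx.
Qed.

(** A potential for one edge of the cycle is constant along the rest of the cycle, and
    so cannot jump across that edge. *)
Lemma cycle_neq0 a c : uniq c -> (3 <= size c)%N -> cycle (alive a) c ->
  local_cohomology_neq0 J 2 (ldeg a).
Proof.
case: c => [|x [|y [|z p]]] // c_uniq _.
(* The distinguished edge is the closing one, from the last vertex back to [x]. *)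
rewrite [cycle _ _]/= rcons_path => /and4P[axy ayz zp alx].
have {zp} yp : path (alive a) y (z :: p) by rewrite /= ayz.
set l := last z p in alx; apply: (alive_neq0 alx) => beta pot.
have xy_lx : [set x; y] != [set l; x].
  apply: contraTneq c_uniq => /setP/(_ y); rewrite !inE eqxx orbT => /esym.
  have [->|_] := eqVneq y x => [_|]; first by rewrite /= inE eqxx.
  by rewrite orbF => /eqP yl; rewrite /= {2}yl mem_last andbF.
suff yl : beta y = beta l.
  by have := potential_neq pot alx; rewrite -yl (potential_eq pot axy xy_lx) eqxx.
have xNp : x \notin y :: z :: p by case/andP: c_uniq.
rewrite /l -[last z p]/(last y (z :: p)).
elim: (z :: p) y yp xNp {c_uniq axy ayz xy_lx} => //= w q IHq y /andP[ayw wq].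
rewrite inE negb_or => /andP[xy xNq]; rewrite -(IHq w) //.
apply: (potential_eq pot ayw); apply/eqP => /setP/(_ x).
move: xNq; rewrite !inE negb_or eqxx orbT => /andP[xw _].
by rewrite (negPf xy) (negPf xw).
Qed.

(** * Extremal exponents *)

Definition spread l (d : int) : 'I_r -> int := fun v => if v \in l then d else 0.

Lemma ldeg_spread l d : uniq l -> ldeg (spread l d) = d *+ size l.
Proof.
move=> l_uniq; rewrite /ldeg -big_mkcond /= -big_uniq //.
by rewrite big_const_seq count_predT -Monoid.iteropE.
Qed.

Lemma spread_ge0 l d v : 0 <= d -> 0 <= spread l d v.
Proof. by rewrite /spread; case: ifP. Qed.

Lemma aliveI a u v : e u v -> (forall k, k != u -> k != v -> 0 <= a k) ->
  ldeg a < n%:Z + a u + a v -> alive a u v.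
Proof.
move=> euv a_ge0 lt_a; apply/and3P; split=> //.
by apply/forallP => k; apply/implyP => /andP[]; apply: a_ge0.
Qed.

Hypothesis n1 : (1 <= n)%N.

Lemma triangle_neq0 x y z : uniq [:: x; y; z] -> cycle e [:: x; y; z] ->
  local_cohomology_neq0 J 2 (3 * n%:Z - 3).
Proof.
move=> c_uniq /and4P[exy eyz ezx _].
have aT := ldeg_spread (n%:Z - 1) c_uniq.
have a_ge0 v : 0 <= spread [:: x; y; z] (n%:Z - 1) v by apply: spread_ge0; lia.
have -> : 3 * n%:Z - 3 = ldeg (spread [:: x; y; z] (n%:Z - 1)) by rewrite aT /=; lia.
apply: (cycle_neq0 c_uniq) => //=.
by rewrite !aliveI // aT /spread !inE !eqxx ?orbT /=; lia.
Qed.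

(** Two opposite vertices with entry n - 1: every edge of the square contains exactly
    one of them and misses the other one. *)
Lemma square_neq0 x y z w : uniq [:: x; y; z; w] -> cycle e [:: x; y; z; w] ->
  local_cohomology_neq0 J 2 (2 * n%:Z - 2).
Proof.
move=> c_uniq /and5P[exy eyz ezw ewx _].
have xz_uniq : uniq [:: x; z].
  by move: c_uniq; rewrite /= !inE !negb_or => /andP[/and3P[_ ->]].
have aT := ldeg_spread (n%:Z - 1) xz_uniq.
have a_ge0 v : 0 <= spread [:: x; z] (n%:Z - 1) v by apply: spread_ge0; lia.
have -> : 2 * n%:Z - 2 = ldeg (spread [:: x; z] (n%:Z - 1)) by rewrite aT /=; lia.
have := a_ge0 y; have := a_ge0 w => aw ay.
apply: (cycle_neq0 c_uniq) => //=.
have ax : spread [:: x; z] (n%:Z - 1) x = n%:Z - 1 by rewrite /spread !inE eqxx.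
have az : spread [:: x; z] (n%:Z - 1) z = n%:Z - 1 by rewrite /spread !inE eqxx orbT.
rewrite !aliveI // aT ?ax ?az /=.
all: by move: aw ay; move: (spread _ _ w) (spread _ _ y) => *; lia.
Qed.

(** For a = 0 all edges are alive. *)
Lemma cycle_neq0_deg0 c : uniq c -> (3 <= size c)%N -> cycle e c ->
  local_cohomology_neq0 J 2 0.
Proof.
move=> c_uniq c_size c_cycle.
have aT : ldeg (spread [::] 0) = 0 by rewrite ldeg_spread.
rewrite -[X in local_cohomology_neq0 _ _ X]aT; apply: (cycle_neq0 c_uniq) => //.
apply: sub_cycle c_cycle => u v euv; apply: aliveI => //.
by rewrite aT /spread /= !addr0; lia.
Qed.

Lemma star_neq0 i j k : e i j -> e i k -> j != k ->
  local_cohomology_neq0 J 2 (2 * n%:Z - 3).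
Proof.
move=> eij eik jk; pose a v := spread [:: j; k] (n%:Z - 1) v + spread [:: i] (-1) v.
have [ij ik] := (edge_irr e_irr eij, edge_irr e_irr eik).
have ai : a i = -1.
  by rewrite /a /spread !inE eqxx (negPf ij) (negPf ik).
have aj : a j = n%:Z - 1.
  by rewrite /a /spread !inE eqxx [j == i]eq_sym (negPf ij) addr0.
have ak : a k = n%:Z - 1.
  by rewrite /a /spread !inE eqxx [k == i]eq_sym (negPf ik) orbT addr0.
have a_ge0 v : v != i -> 0 <= a v.
  by move=> vi; rewrite /a {2}/spread inE (negPf vi) addr0 spread_ge0 //; lia.
have aT : ldeg a = 2 * n%:Z - 3.
  rewrite /ldeg big_split -!/(ldeg _) !ldeg_spread //= ?inE ?jk //; lia.
rewrite -aT; apply: (@branch_neq0 a i j k) => //; last by rewrite ai.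
  by apply: aliveI => //; [move=> v /a_ge0|rewrite aT ai aj; lia].
by apply: aliveI => //; [move=> v /a_ge0|rewrite aT ai ak; lia].
Qed.

Lemma single_edge_neq0 i j k : e i j -> i != k -> j != k ->
  local_cohomology_neq0 J 2 (n%:Z - 3).
Proof.
move=> eij ik jk; pose a v := spread [:: k] (n%:Z - 1) v + spread [:: i; j] (-1) v.
have ij := edge_irr e_irr eij.
have ai : a i = -1 by rewrite /a /spread !inE eqxx (negPf ik).
have aj : a j = -1 by rewrite /a /spread !inE eqxx (negPf jk) orbT.
have aT : ldeg a = n%:Z - 3.
  rewrite /ldeg big_split -!/(ldeg _) !ldeg_spread //= ?inE ?ij //; lia.
rewrite -aT; apply: (@two_negative_neq0 a i j); rewrite ?ai ?aj //.
apply: aliveI => //; last by rewrite aT ai aj; lia.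
move=> v vi vj; rewrite /a {2}/spread !inE (negPf vi) (negPf vj) addr0.
by apply: spread_ge0; lia.
Qed.

End AliveGraph.

(** * The a-invariant *)

Lemma cycle_girth (T : finType) (e e' : rel T) (c : seq T) :
  subrel e' e -> uniq c -> (3 <= size c)%N -> cycle e' c ->
  exists2 g, girth e = Some g & (g <= size c)%N.
Proof.
move=> sub_e c_uniq c_size c_cycle.
have : has_cycle_of_length e (size c).
  rewrite /has_cycle_of_length c_size; apply/existsP; exists (in_tuple c).
  by rewrite c_uniq andbT; apply: sub_cycle c_cycle.
have := girthP e; case: (girth e) => [g [_ min_g] /min_g|no_cycle]; first by exists g.
by rewrite (negPf (no_cycle _)).
Qed.

Lemma girth_cycle (T : finType) (e : rel T) (g : nat) : girth e = Some g ->
  exists c : seq T, [/\ size c = g, (3 <= g)%N, uniq c & cycle e c].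
Proof.
move=> eg; have := girthP e; rewrite eg => -[/andP[g3 /existsP[c /andP[cc uc]]] _].
by exists c; rewrite size_tuple.
Qed.

Lemma max_degree_ge2 (T : finType) (e : rel T) :
  (2 <= max_degree e)%N -> exists i j k, [/\ e i j, e i k & j != k].
Proof.
move=> deg2; have [/existsP[i]|no_i] := boolP [exists i, (1 < #|[set j | e i j]|)%N].
  by case/card_gt1P => j [k [/[!inE] eij eik jk]]; exists i, j, k.
move: deg2; rewrite ltnNge; case/negP; apply/bigmax_leqP => i _.
by rewrite leqNgt; apply: contraNN no_i => ?; apply/existsP; exists i.
Qed.

Lemma max_degree_le1 (T : finType) (e : rel T) i j k :
  (max_degree e <= 1)%N -> e i j -> e i k -> j = k.
Proof.
move/bigmax_leqP/(_ i isT) => deg_i eij eik; apply/eqP; apply: contraTT deg_i => jk.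
by rewrite -ltnNge; apply/card_gt1P; exists j, k; split; rewrite ?inE.
Qed.

Lemma exists_third r (i j : 'I_r) : (3 <= r)%N -> exists k, (i != k) && (j != k).
Proof.
move=> r3; have : (0 < #|~: [set i; j]|)%N.
  by have := cardsC [set i; j]; rewrite card_ord cards2; case: (_ != _) => /=; lia.
case/card_gt0P => k; rewrite !inE negb_or => /andP[ki kj].
by exists k; rewrite ![_ == k]eq_sym ki kj.
Qed.

Theorem proposition3p19 :
  forall (K : fieldType) (r : nat) (e : rel 'I_r) (n : nat),
  (3 <= r)%N ->
  ssrbool.symmetric e -> irreflexive e ->
  (forall i, exists j, e i j) ->
  (1 <= n)%N ->
  let a2_is (a : int) :=
    is_a_invariant
      (ideal_exp (@stanley_reisner K r (is_face e)) n) 2 (Some a) in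
  (girth e = Some 3 -> a2_is (3 * n%:Z - 3)%R) /\
  (girth e = Some 4 -> a2_is (2 * n%:Z - 2)%R) /\
  (forall g, girth e = Some g -> (5 <= g)%N -> (2 <= n)%N ->
     a2_is (2 * n%:Z - 3)%R) /\
  (forall g, girth e = Some g -> (5 <= g)%N -> n = 1 -> a2_is 0%R) /\
  (girth e = None -> (2 <= max_degree e)%N -> a2_is (2 * n%:Z - 3)%R) /\
  (girth e = None -> max_degree e = 1 -> a2_is (n%:Z - 3)%R).
Proof.
move=> K r e n r3 e_sym e_irr no_isolated n1 a2_is.
pose neq0 := local_cohomology_neq0 (ideal_exp (@stanley_reisner K r (is_face e)) n) 2.
have a2I d : neq0 d -> (forall t, (d < t)%R -> ~ neq0 t) -> a2_is d.
  by move=> d_neq0 max_d; split=> // t; case: leP => // /max_d.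
have vanish t := @local_cohomology_eq0 K r e n e_sym e_irr t.
have aliveE a : subrel (alive e n a) e by move=> u v; apply: alive_edge.
split=> [eg|].
  have [c [c_size _ c_uniq c_cycle]] := girth_cycle eg.
  case: c c_size c_uniq c_cycle => [|x [|y [|z []]]] // _ c_uniq c_cycle.
  apply: a2I => [|t dt]; first exact: triangle_neq0 c_uniq c_cycle.
  apply: vanish => [|*|a c a_ge0 at_ cu c3]; [lia|lia|].
  apply: contraTN dt => cc; rewrite -leNgt -at_.
  have [c4|] := leqP 4 (size c); first by have := alive_cycle4 a_ge0 cu cc c4; lia.
  rewrite ltnS => c_le3; apply: alive_cycle3 cc _ => //.
  by apply/eqP; rewrite eqn_leq c3 andbT.
split=> [eg|].
  have [c [c_size _ c_uniq c_cycle]] := girth_cycle eg.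
  case: c c_size c_uniq c_cycle => [|x [|y [|z [|w []]]]] // _ c_uniq c_cycle.
  apply: a2I => [|t dt]; first exact: square_neq0 c_uniq c_cycle.
  apply: vanish => [|*|a c a_ge0 at_ cu c3]; [lia|lia|].
  apply: contraTN dt => cc; rewrite -leNgt -at_.
  have [g] := cycle_girth (aliveE a) cu c3 cc; rewrite eg => -[<-].
  exact: alive_cycle4 a_ge0 cu cc.
split=> [g eg g5 n2|].
  have [c [c_size g3 c_uniq c_cycle]] := girth_cycle eg.
  rewrite -c_size in g3.
  case: c g3 c_uniq c_cycle {c_size} => [|x [|y [|z c]]] // _ c_uniq c_cycle.
  apply: a2I => [|t dt].
    have /and3P[exy eyz _] := c_cycle.
    apply: (star_neq0 _ e_sym e_irr n1 _ eyz (j := x)); first by rewrite e_sym.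
    by move: c_uniq; rewrite /= !inE !negb_or => /andP[/and3P[]].
  apply: vanish => [|*|a c' a_ge0 at_ cu c3]; [lia|lia|].
  apply: contraTN dt => cc; rewrite -leNgt -at_.
  have [g'] := cycle_girth (aliveE a) cu c3 cc; rewrite eg => -[<-] g_le.
  by apply: alive_cycle5 cu cc _ n2; rewrite ?(leq_trans g5).
split=> [g eg g5 n_eq1|].
  have [c [c_size g3 c_uniq c_cycle]] := girth_cycle eg.
  apply: a2I => [|t dt].
    by rewrite -c_size in g3; apply: cycle_neq0_deg0 c_uniq g3 c_cycle.
  apply: vanish => [|*|a c' a_ge0 at_ cu c3]; [lia|lia|].
  apply: contraTN dt => cc; rewrite -leNgt -at_.
  have [g'] := cycle_girth (aliveE a) cu c3 cc; rewrite eg => -[<-] g_le.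
  by have := alive_cycle4 a_ge0 cu cc (leq_trans (ltnW g5) g_le); lia.
split=> [eg /max_degree_ge2[i [j [k [eij eik jk]]]]|eg deg1].
  apply: a2I => [|t dt]; first exact: star_neq0 eij eik jk.
  apply: vanish => [|*|a c a_ge0 at_ cu c3]; [lia|lia|].
  by apply/negP => /(cycle_girth (aliveE a) cu c3)[]; rewrite eg.
have [j eij] := no_isolated (Ordinal (ltnW (ltnW r3))).
have [k /andP[ik jk]] := exists_third (Ordinal (ltnW (ltnW r3))) j r3.
apply: a2I => [|t dt]; first exact: single_edge_neq0 eij ik jk.
apply: vanish => [//|i u v eiu eiv uv|a c a_ge0 at_ cu c3].
  by rewrite (max_degree_le1 _ eiu eiv) ?deg1 ?eqxx in uv.
by apply/negP => /(cycle_girth (aliveE a) cu c3)[]; rewrite eg.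
Qed.
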